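(* Let $0<a<b$ be real numbers, let $r$ be a positive integer, and let $f$ be a real valued function such that $f^{(r+1)}$ exists and is continuous in some open interval containing $[a,b]$ and has no zeros in $[a,b]$. Let $P_{c}$ denote the Taylor polynomial to $f$ of order $r$ at $x=c$. (i) If $r$ is odd, then $P_{b}-P_{a}$ has precisely one real zero $x_{0}$, and $a<x_{0}<b$. (ii) If $r$ is even, then all zeros of $P_{b}-P_{a}$ in $\mathbb{C}$ are nonreal.
   Context: The Taylor polynomial to $f$ of order $r$ at $c$ is $P_c(z)=\sum_{k=0}^{r}\frac{f^{(k)}(c)}{k!}(z-c)^k$, regarded as a polynomial in the complex variable $z$. *)

(* Defs.v *)
(* MathComp / MathComp-Analysis, over an arbitrary R : realType; complex numbers
   are R[i] from mathcomp-real-closed. *)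
From mathcomp Require Import all_boot all_order all_algebra.
From mathcomp Require Import all_classical all_reals all_analysis.
From mathcomp Require Import complex.

Set Implicit Arguments.
Unset Strict Implicit.
Unset Printing Implicit Defensive.

Import Order.TTheory GRing.Theory Num.Theory.
Import numFieldNormedType.Exports.

Local Open Scope classical_set_scope.
Local Open Scope ring_scope.
Local Open Scope complex_scope.

(* [derive1n] is total, with unspecified values where the limit does not exist,
   so existence of the n-th derivative on [I] must be required at every order
   up to [n], not only at the last one. *)
Definition derivable_upto (R : realType) (n : nat) (f : R -> R) (I : set R) :
    Prop :=
  forall k : nat, (k < n)%N -> forall x : R, I x -> derivable (derive1n k f) x 1.

Definition taylor_poly (R : realType) (r : nat) (f : R -> R) (c : R) :
    {poly R[i]} :=
  \sum_(k < r.+1) ((derive1n k f c / k`!%:R)%:C) *: ('X - (c%:C)%:P) ^+ k.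

(* Main.v *)
(* For fixed real x the Taylor polynomials P_t of order n satisfy
   d/dt P_t(x) = f^(n+1)(t) (x - t)^n / n!, where f^(n+1) has constant sign on
   [a, b], say positive.  If n is even, t |-> P_t(x) is strictly increasing on
   [a, b] for every x, so P_b - P_a has no real zero.  If n is odd, the
   derivative of P_b - P_a is the same difference for f' at the even order
   n - 1, hence positive, so P_b - P_a is strictly increasing on R; it is
   negative at a and positive at b by the formula for d/dt P_t. *)
Require Import Defs.
From mathcomp Require Import all_boot all_order all_algebra.
From mathcomp Require Import all_classical all_reals all_analysis.
From mathcomp Require Import complex.
From mathcomp Require Import ring.

Set Implicit Arguments.
Unset Strict Implicit.
Unset Printing Implicit Defensive.

Import Order.TTheory GRing.Theory Num.Theory.
Import numFieldNormedType.Exports.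

Local Open Scope classical_set_scope.
Local Open Scope ring_scope.
Local Open Scope complex_scope.

(** By the mean value theorem. Positivity is asked only strictly inside the interval, because the
    derivative of a Taylor sum in its centre [t] may vanish at [t = x], and [x] will occur as an
    endpoint. *)
Lemma is_derive_gt0_lt (R : realType) (g dg : R -> R) (a b : R) :
  a < b -> (forall t, a <= t <= b -> is_derive t 1 g (dg t)) ->
  (forall t, a < t < b -> 0 < dg t) -> g a < g b.
Proof.
move=> ab gD dg_gt0.
have gC : {within `[a, b], continuous g}.
  by apply: derivable_within_continuous => t; rewrite in_itv /= => /gD [].
have [|t] := @MVT _ g dg a b ab _ gC.
  by move=> t; rewrite in_itv /= => /andP[at_ tb]; apply: gD; rewrite !ltW.
rewrite in_itv /= => /dg_gt0 dt_gt0 gE.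
by rewrite -subr_gt0 gE mulr_gt0 // subr_gt0.
Qed.

(** Here [n] counts terms, so order [r] means [r.+1] terms; the empty sum serves as the derivative
    of an order 0 polynomial. *)
Definition taylor_sum (R : realType) (F : nat -> R -> R) (n : nat) (c x : R) :
    R :=
  \sum_(k < n) F k c / k`!%:R * (x - c) ^+ k.

(* Stated for a sequence F of successive derivatives rather than for [derive1n],
   so that passing to f' and to - f amounts to shifting and negating F. *)
Definition derivative_tower (R : realType) (F : nat -> R -> R) (n : nat)
    (a b : R) : Prop :=
  forall k t, (k < n)%N -> a <= t <= b -> is_derive t 1 (F k) (F k.+1 t).

(** The derivative telescopes: by the product rule each new term contributes two summands, one of
    which cancels the derivative of the preceding sum. *)
Lemma is_derive_taylor_sum_center (R : realType) (F : nat -> R -> R) (n : nat)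
    (t x : R) :
  (forall k, (k <= n)%N -> is_derive t 1 (F k) (F k.+1 t)) ->
  is_derive t 1 (fun s => taylor_sum F n.+1 s x)
    (F n.+1 t / n`!%:R * (x - t) ^+ n).
Proof.
elim: n => [|n IHn] FD.
  have -> : (fun s => taylor_sum F 1 s x) = F 0%N.
    by apply/funext => s; rewrite /taylor_sum big_ord1 fact0 divr1 expr0 mulr1.
  by rewrite fact0 divr1 expr0 mulr1; apply: FD.
have FnD := FD n.+1 (leqnn _).
have TnD := IHn (fun k kn => FD k (leqW kn)).
have -> : (fun s => taylor_sum F n.+2 s x) =
    (fun s => taylor_sum F n.+1 s x) +
    (n.+1`!%:R^-1 *: F n.+1) * (cst x - id) ^+ n.+1.
  apply/funext => s; rewrite {1}/taylor_sum big_ord_recr /=.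
  by rewrite !fctE /= [X in _ + X * _]mulrC.
apply: is_derive_eq.
rewrite !fctE /= /GRing.scale /= factS natrM.
have n1 : 1 + n%:R != 0 :> R by rewrite nat1r pnatr_eq0.
have nf : n`!%:R != 0 :> R by rewrite pnatr_eq0 -lt0n fact_gt0.
rewrite sub0r exprS.
by field; rewrite nf n1.
Qed.

Lemma is_derive_taylor_sum (R : realType) (F : nat -> R -> R) (n : nat)
    (c x : R) :
  is_derive x 1 (taylor_sum F n.+1 c) (taylor_sum (fun k => F k.+1) n c x).
Proof.
elim: n => [|n IHn].
  have -> : taylor_sum F 1 c = cst (F 0%N c).
    by apply/funext => s; rewrite /taylor_sum big_ord1 fact0 divr1 expr0 mulr1.
  by rewrite /taylor_sum big_ord0; apply: is_derive_cst.
have -> : taylor_sum F n.+2 c =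
    taylor_sum F n.+1 c + (F n.+1 c / n.+1`!%:R) *: (id - cst c) ^+ n.+1.
  apply/funext => s; rewrite {1}/taylor_sum big_ord_recr /=.
  by rewrite !fctE /=.
apply: is_derive_eq.
rewrite [RHS]/taylor_sum big_ord_recr /= -/(taylor_sum _ _ _ _).
rewrite !fctE /= /GRing.scale /= factS natrM.
have n1 : 1 + n%:R != 0 :> R by rewrite nat1r pnatr_eq0.
have nf : n`!%:R != 0 :> R by rewrite pnatr_eq0 -lt0n fact_gt0.
by congr (_ + _); field; rewrite nf n1.
Qed.

Lemma taylor_sum_lt_even (R : realType) (F : nat -> R -> R) (n : nat)
    (a b x : R) :
  a < b -> ~~ odd n -> derivative_tower F n.+1 a b ->
  (forall t, a <= t <= b -> 0 < F n.+1 t) ->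
  taylor_sum F n.+1 a x < taylor_sum F n.+1 b x.
Proof.
move=> ab n_even FD F_gt0.
pose dT t := F n.+1 t / n`!%:R * (x - t) ^+ n.
(* The even power in [dT] is positive except possibly at [t = x]. Hence monotonicity is shown on
   intervals without [x] in their interior, and [[a, b]] is split at [x] when needed. *)
have piece u v : a <= u -> u < v -> v <= b -> (x <= u) || (v <= x) ->
    taylor_sum F n.+1 u x < taylor_sum F n.+1 v x.
  move=> au uv vb xuv.
  apply: (is_derive_gt0_lt (g := fun t => taylor_sum F n.+1 t x) (dg := dT));
    rewrite // => t /andP[ut tv].
    apply: is_derive_taylor_sum_center => k kn; apply: FD => //.
    by rewrite (le_trans au ut) (le_trans tv vb).
  rewrite /dT mulr_gt0 //.
    rewrite divr_gt0 ?ltr0n ?fact_gt0 // F_gt0 //.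
    by rewrite (le_trans au (ltW ut)) (le_trans (ltW tv) vb).
  rewrite exprn_even_gt0 // subr_eq0; apply/orP; right.
  case/orP: xuv => [xu|vx].
    by rewrite lt_eqF // (le_lt_trans xu).
  by rewrite gt_eqF // (lt_le_trans tv).
have [xa|ax] := leP x a; first by apply: piece; rewrite ?xa.
have [bx|xb] := leP b x; first by apply: piece; rewrite ?bx ?orbT.
by apply: (@lt_trans _ _ (taylor_sum F n.+1 x x));
  apply: piece; rewrite ?lexx ?orbT // ltW.
Qed.

Lemma taylor_sum_zero_odd (R : realType) (F : nat -> R -> R) (n : nat)
    (a b : R) :
  a < b -> odd n -> derivative_tower F n.+1 a b ->
  (forall t, a <= t <= b -> 0 < F n.+1 t) ->
  exists2 x0, a < x0 < b &
    forall x, taylor_sum F n.+1 a x = taylor_sum F n.+1 b x <-> x = x0.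
Proof.
(* An odd order is a successor; from here on the order is [n.+1] with [n] even, and [dQ] is the
   difference for the shifted sequence at order [n]. *)
case: n => // n ab n_odd FD F_gt0.
pose Q x := taylor_sum F n.+2 b x - taylor_sum F n.+2 a x.
pose dQ x := taylor_sum (fun k => F k.+1) n.+1 b x -
             taylor_sum (fun k => F k.+1) n.+1 a x.
have QD (x : R) : is_derive x 1 Q (dQ x).
  have Db := is_derive_taylor_sum F n.+1 b x.
  have Da := is_derive_taylor_sum F n.+1 a x.
  exact: is_deriveB.
have dQ_gt0 (x : R) : 0 < dQ x.
  rewrite subr_gt0; apply: taylor_sum_lt_even => // k t kn.
  exact: (FD k.+1).
have Q_lt (x y : R) : x < y -> Q x < Q y.
  by move=> xy; apply: (is_derive_gt0_lt (dg := dQ)).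
have Qa_lt0 : Q a < 0.
  (* For [t > a] the odd power of [a - t] is negative, so the Taylor sum at [a] decreases in its
     centre; negating it gives an increasing function. *)
  rewrite subr_lt0 -ltrN2.
  apply: (is_derive_gt0_lt (g := fun t => - taylor_sum F n.+2 t a)
    (dg := fun t => - (F n.+2 t / n.+1`!%:R * (a - t) ^+ n.+1))) => // t tab.
    have TD := @is_derive_taylor_sum_center R F n.+1 t a
      (fun k kn => FD k t kn tab).
    exact: is_deriveN.
  case/andP: tab => at_ tb.
  rewrite oppr_gt0 pmulr_rlt0 ?exprn_odd_lt0 ?subr_lt0 //.
  by rewrite divr_gt0 ?ltr0n ?fact_gt0 // F_gt0 // !ltW.
have Qb_gt0 : 0 < Q b.
  rewrite subr_gt0.
  apply: (is_derive_gt0_lt (g := fun t => taylor_sum F n.+2 t b)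
    (dg := fun t => F n.+2 t / n.+1`!%:R * (b - t) ^+ n.+1)) => // t tab.
    by apply: is_derive_taylor_sum_center => k kn; apply: FD.
  case/andP: tab => at_ tb.
  rewrite pmulr_rgt0 ?exprn_odd_gt0 ?subr_gt0 //.
  by rewrite divr_gt0 ?ltr0n ?fact_gt0 // F_gt0 // !ltW.
have [||x0] := @IVT R Q a b 0 (ltW ab).
- by apply: derivable_within_continuous => t _; case: (QD t).
- by rewrite ge_min (ltW Qa_lt0) le_max (ltW Qb_gt0) orbT.
rewrite in_itv /= => /andP[ax0 x0b] Qx0.
exists x0.
  rewrite !lt_neqAle ax0 x0b !andbT; apply/andP; split; apply/eqP => x0E.
    by move: Qa_lt0; rewrite x0E Qx0 ltxx.
  by move: Qb_gt0; rewrite -x0E Qx0 ltxx.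
move=> x; split=> [xE|->]; last by apply/esym/subr0_eq.
have Qx : Q x = 0 by rewrite /Q xE subrr.
by case: (ltgtP x x0) => // /Q_lt; rewrite Qx Qx0 ltxx.
Qed.

Lemma taylor_sumN (R : realType) (F : nat -> R -> R) (n : nat) (c x : R) :
  taylor_sum (fun k => - F k) n c x = - taylor_sum F n c x.
Proof.
by rewrite /taylor_sum -sumrN; apply: eq_bigr => k _; rewrite fctE !mulNr.
Qed.

Lemma derivative_towerN (R : realType) (F : nat -> R -> R) (n : nat) (a b : R) :
  derivative_tower F n a b -> derivative_tower (fun k => - F k) n a b.
Proof.
by move=> FD k t kn tab; have FkD := FD k t kn tab; apply: is_deriveN.
Qed.

(** A change of sign between two points would force a zero by the intermediate value theorem, so the
    sign at [a] decides everywhere. *)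
Lemma continuous_neq0_sign (R : realType) (g : R -> R) (a b : R) :
  {within `[a, b], continuous g} ->
  (forall t, a <= t <= b -> g t <> 0) ->
  (forall t, a <= t <= b -> 0 < g t) \/ (forall t, a <= t <= b -> 0 < - g t).
Proof.
move=> gC g_neq0.
have same_sign u v : a <= u -> u <= v -> v <= b -> (0 < g u) = (0 < g v).
  move=> au uv vb.
  have guC : {within `[u, v], continuous g}.
    by apply: continuous_subspaceW gC; apply: subset_itv; rewrite bnd_simp.
  have no_zero : ~~ (Num.min (g u) (g v) <= 0 <= Num.max (g u) (g v)).
    apply/negP => /(IVT uv guC)[t]; rewrite in_itv /= => /andP[ut tv].
    by apply: g_neq0; rewrite (le_trans au ut) (le_trans tv vb).
  by apply/idP/idP => g_gt0; rewrite ltNge; apply: contra no_zero => g_le0;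
    rewrite ge_min le_max g_le0 (ltW g_gt0) ?orbT.
have [ga|ga] := ltP 0 (g a); [left|right] => t /andP[at_ tb].
  by rewrite -(same_sign a t).
rewrite oppr_gt0 lt_neqAle leNgt -(same_sign a t) // -leNgt ga andbT.
by apply/eqP/g_neq0; rewrite at_.
Qed.

(** Since the embedding of the reals is injective, this turns real roots of the complex polynomial
    into solutions of an equation between real Taylor sums. *)
Lemma horner_taylor_poly (R : realType) (r : nat) (f : R -> R) (c x : R) :
  (taylor_poly r f c).[x%:C] =
  (taylor_sum (fun k => derive1n k f) r.+1 c x)%:C.
Proof.
rewrite /taylor_poly /taylor_sum horner_sum rmorph_sum /=.
apply: eq_bigr => k _.
by rewrite hornerZ horner_exp hornerXsubC [RHS]rmorphM rmorphXn rmorphB.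
Qed.

Local Open Scope complex_scope.

Theorem proposition1 (R : realType) (a b : R) (r : nat) (f : R -> R)
    (I : set R) (a_gt0 : 0 < a) (ltab : a < b) (r_gt0 : (0 < r)%N)
    (openI : open I) (itvI : is_interval I) (abI : `[a, b]%classic `<=` I)
    (f_deriv : derivable_upto r.+1 f I)
    (f_cont : {in I, continuous (derive1n r.+1 f)})
    (f_neq0 : forall x : R, a <= x <= b -> derive1n r.+1 f x <> 0) :
  (odd r ->
     exists x0 : R, a < x0 < b /\
       forall z : R[i],
         (root (taylor_poly r f b - taylor_poly r f a) z /\ complex.Im z = 0)
         <-> z = x0%:C) /\
  (~~ odd r ->
     forall z : R[i],
       root (taylor_poly r f b - taylor_poly r f a) z -> complex.Im z <> 0).
Proof.
pose F k := derive1n k f.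
have FD : derivative_tower F r.+1 a b.
  move=> k t kr tab.
  have fD : derivable (F k) t 1 by apply: f_deriv => //; apply: abI.
  by rewrite /F derive1nS derive1E; apply: derivableP.
have FC : {within `[a, b], continuous (F r.+1)}.
  apply: continuous_in_subspaceT => t /set_mem tab.
  by apply: f_cont; apply/mem_set/abI.
have rootE x : root (taylor_poly r f b - taylor_poly r f a) x%:C <->
    taylor_sum F r.+1 a x = taylor_sum F r.+1 b x.
  rewrite rootE hornerD hornerN !horner_taylor_poly -rmorphB /= fmorph_eq0.
  rewrite subr_eq0; split=> [/eqP ->|->] //.
have realE (z : R[i]) : complex.Im z = 0 -> z = (complex.Re z)%:C.
  by case: z => u v /= ->.
have sign := continuous_neq0_sign FC f_neq0.
split=> [r_odd|r_even].
  have [x0 x0ab x0P] : exists2 x0, a < x0 < b & forall x,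
      taylor_sum F r.+1 a x = taylor_sum F r.+1 b x <-> x = x0.
    case: sign => [F_gt0|NF_gt0]; first exact: taylor_sum_zero_odd.
    (* When the top derivative is negative, passing to [- F] negates both Taylor sums and keeps the
       points where they agree. *)
    have [x0 x0ab x0P] :=
      taylor_sum_zero_odd ltab r_odd (derivative_towerN FD) NF_gt0.
    exists x0 => // x; rewrite -x0P !taylor_sumN.
    by split=> [-> //|/oppr_inj].
  exists x0; split=> // z; split=> [[zroot /realE zE]|->].
    by rewrite zE; congr (_%:C); apply/x0P/rootE; rewrite -zE.
  by split=> //; apply/rootE/x0P.
move=> z zroot /realE zE; move: zroot; rewrite zE => /rootE Tab.
case: sign => [F_gt0|NF_gt0].
  have := taylor_sum_lt_even (complex.Re z) ltab r_even FD F_gt0.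
  by rewrite Tab ltxx.
have := taylor_sum_lt_even (complex.Re z) ltab r_even (derivative_towerN FD)
  NF_gt0.
by rewrite !taylor_sumN Tab ltxx.
Qed.
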